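(* For every computable copy $\mathcal{L}$ of $\omega$, there is a $\Pi_2$ cohesive set $C$ such that $\prod_C \mathcal{L} \not\cong \omega + \eta$.
   Context: $\Pi_2$ refers to the arithmetical hierarchy of subsets of $\mathbb{N}$; c.e. means computably enumerable. For $X, Y \subseteq \mathbb{N}$, $X \subseteq^* Y$ means that $X \setminus Y$ is finite. A set $C \subseteq \mathbb{N}$ is cohesive if it is infinite and for every c.e. set $W$, either $C \subseteq^* W$ or $C \subseteq^* \mathbb{N} \setminus W$. A computable linear order $\mathcal{L} = (L; \prec_{\mathcal{L}})$ consists of a non-empty computable set $L \subseteq \mathbb{N}$ and a computable (strict) linear order relation $\prec_{\mathcal{L}}$ on $L$. A computable copy of $\omega$ is a computable linear order that is isomorphic to $(\mathbb{N}; <)$ (by a not necessarily computable isomorphism). $\omega$ and $\eta$ denote the order-types of $(\mathbb{N};<)$ and $(\mathbb{Q};<)$, and $+$ is the usual sum of linear orders. Cohesive power: for a computable linear order $\mathcal{L} = (L; \prec_{\mathcal{L}})$ and a cohesive set $C$, let $D$ be the set of partial computable functions $\varphi \colon \mathbb{N} \rightharpoonup L$ with $C \subseteq^* \mathrm{dom}(\varphi)$. For $\varphi, \psi \in D$, let $\varphi =_C \psi$ if $C \subseteq^* \{n : \varphi(n)\downarrow = \psi(n)\downarrow\}$; this is an equivalence relation, and $[\varphi]$ denotes the class of $\varphi$. The cohesive power $\prod_C \mathcal{L}$ is the linear order with domain $\{[\varphi] : \varphi \in D\}$ where $[\psi] \prec [\varphi]$ if and only if $C \subseteq^* \{n : \psi(n)\downarrow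 \prec_{\mathcal{L}} \varphi(n)\downarrow\}$. *)

(* Defs.v *)
From mathcomp Require Import all_boot all_order all_algebra.
From mathcomp Require Import all_classical.

Set Implicit Arguments.
Unset Strict Implicit.
Unset Printing Implicit Defensive.

Local Open Scope classical_set_scope.

(* Kleene's partial recursive functions, indexed by their arity. *)
Inductive recfun : nat -> Type :=
| RZero n : recfun n
| RSucc : recfun 1
| RProj n (i : 'I_n) : recfun n
| RComp m n (f : recfun m) (g : 'I_m -> recfun n) : recfun n
| RPrec n (f : recfun n) (g : recfun n.+2) : recfun n.+1
| RMu n (f : recfun n.+1) : recfun n.

(* h(0, v) = f(v) and h(x + 1, v) = g(x, h(x, v), v), on graphs. *)
Fixpoint prec_graph n (F : n.-tuple nat -> nat -> Prop)
    (G : n.+2.-tuple nat -> nat -> Prop) (v : n.-tuple nat) (x y : nat) : Prop :=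
  if x is x'.+1 then
    exists z, prec_graph F G v x' z /\ G [tuple of [:: x', z & v]] y
  else F v y.

(* [eval c v y] means that the function described by [c] converges on [v] with
   value [y].  In the unbounded search, all values before the first zero must
   be defined. *)
Fixpoint eval n (c : recfun n) : n.-tuple nat -> nat -> Prop :=
  match c in recfun n return n.-tuple nat -> nat -> Prop with
  | RZero _ => fun _ y => y = 0
  | RSucc => fun v y => y = (thead v).+1
  | RProj _ i => fun v y => y = tnth v i
  | RComp m _ f g => fun v y => exists w : m.-tuple nat,
      (forall i, eval (g i) v (tnth w i)) /\ eval f w y
  | RPrec _ f g => fun v y =>
      prec_graph (eval f) (eval g) [tuple of behead v] (thead v) y
  | RMu _ f => fun v y => eval f [tuple of y :: v] 0 /\
      (forall x, x < y -> exists z, eval f [tuple of x :: v] z.+1)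
  end.

(* Partial functions are coded with [option]: [None] is divergence. *)
Definition pfun := nat -> option nat.

Definition partial_computable (phi : pfun) : Prop :=
  exists c : recfun 1, forall x y, phi x = Some y <-> eval c [tuple x] y.

Definition pdom (phi : pfun) : set nat := [set n | exists y, phi n = Some y].

Definition decides n (c : recfun n) (v : n.-tuple nat) (P : Prop) : Prop :=
  (P -> eval c v 1) /\ (~ P -> eval c v 0).

Definition computable_set (A : set nat) : Prop :=
  exists c : recfun 1, forall x, decides c [tuple x] (A x).

Definition computable_rel2 (R : nat -> nat -> Prop) : Prop :=
  exists c : recfun 2, forall x y, decides c [tuple x; y] (R x y).

Definition computable_rel3 (R : nat -> nat -> nat -> Prop) : Prop :=
  exists c : recfun 3, forall x y z, decides c [tuple x; y; z] (R x y z).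

Definition ce_set (W : set nat) : Prop :=
  exists phi, partial_computable phi /\ W = pdom phi.

Definition Pi2_set (A : set nat) : Prop :=
  exists R, computable_rel3 R /\
    forall x, A x <-> forall y, exists z, R x y z.

Definition almost_subset (X Y : set nat) : Prop := finite_set (X `\` Y).

Definition cohesive (C : set nat) : Prop :=
  infinite_set C /\
  forall W, ce_set W -> almost_subset C W \/ almost_subset C (~` W).

(* A strict linear order is a carrier set with a relation on the ambient type;
   only the restriction of the relation to the carrier matters. *)
Definition order_iso T U (A : set T) (ltA : T -> T -> Prop)
    (B : set U) (ltB : U -> U -> Prop) : Prop :=
  exists f : T -> U, set_bij A B f /\
    forall x y, A x -> A y -> (ltA x y <-> ltB (f x) (f y)).

Definition strict_linear_order T (A : set T) (lt : T -> T -> Prop) : Prop :=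
  [/\ forall x, A x -> ~ lt x x,
      forall x y z, A x -> A y -> A z -> lt x y -> lt y z -> lt x z &
      forall x y, A x -> A y -> [\/ lt x y, x = y | lt y x]].

Definition computable_linear_order (L : set nat) (lt : nat -> nat -> Prop) :
    Prop :=
  [/\ L !=set0, computable_set L,
      forall x y, lt x y -> L x /\ L y,
      computable_rel2 lt & strict_linear_order L lt].

Definition computable_copy_of_omega (L : set nat) (lt : nat -> nat -> Prop) :
    Prop :=
  computable_linear_order L lt /\
  order_iso L lt [set: nat] (fun m n => m < n).

Definition power_fun (L C : set nat) : set pfun :=
  [set phi | [/\ partial_computable phi,
                 forall n y, phi n = Some y -> L y &
                 almost_subset C (pdom phi)]].

Definition power_eq (C : set nat) (phi psi : pfun) : Prop :=
  almost_subset C [set n | exists y, phi n = Some y /\ psi n = Some y].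

Definition power_class (L C : set nat) (phi : pfun) : set pfun :=
  [set psi | power_fun L C psi /\ power_eq C phi psi].

Definition power_dom (L C : set nat) : set (set pfun) :=
  [set power_class L C phi | phi in power_fun L C].

(* The defining condition does not depend on the choice of representatives. *)
Definition power_lt (lt : nat -> nat -> Prop) (C : set nat)
    (K H : set pfun) : Prop :=
  exists psi phi, [/\ K psi, H phi &
    almost_subset C [set n | exists x y,
      [/\ psi n = Some x, phi n = Some y & lt x y]]].

Definition sum_lt T U (ltT : T -> T -> Prop) (ltU : U -> U -> Prop)
    (a b : T + U) : Prop :=
  match a, b with
  | inl x, inl y => ltT x y
  | inl _, inr _ => True
  | inr _, inl _ => False
  | inr x, inr y => ltU x y
  end.

Definition omega_plus_eta_lt : nat + rat -> nat + rat -> Prop :=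
  sum_lt (fun m n : nat => m < n) (fun p q : rat => (p < q)%R).

(* Main.v *)
(* Let A be the set of codes p of pairs of neighbours of L, and let phi(p) < psi(p) be
   the components of p.  A is infinite and Pi_1.  For every infinite C included in A
   the class of phi lies above all the constants, and no theta lies strictly between
   phi and psi almost everywhere on C; but in omega + eta no element with infinitely
   many predecessors has an immediate successor.

   It remains to find a Pi_2 cohesive set inside A.  Put V_0 = ~ A and let V_1, V_2,
   ... list the c.e. sets.  Let c_e be the least number >= e whose membership in
   V_0, ..., V_e is lexicographically minimal among all numbers >= e.  For each k the
   membership of c_e in V_0, ..., V_k is lexicographically nondecreasing in e, hence
   eventually constant, so C = {c_0, c_1, ...} is cohesive, and it avoids V_0.
   Since e <= c_e, membership in C is a bounded existential quantifier over
   comparisons of limits of computable monotone approximations, which is Pi_2 by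
   compactness. *)
Require Import Defs.
From mathcomp Require Import all_boot all_order all_algebra.
From mathcomp Require Import all_classical.
From mathcomp Require Import zify.

Set Implicit Arguments.
Unset Strict Implicit.
Unset Printing Implicit Defensive.

Local Open Scope classical_set_scope.

(** * Computable functions and decidable relations *)

Lemma eval_inj n (c : recfun n) v y z : eval c v y -> eval c v z -> y = z.
Proof.
elim: c v y z => {n} [n|||m n f IHf g IHg|n f IHf g IHg|n f IHf] v y z /=.
- by move=> -> ->.
- by move=> -> ->.
- by move=> n i -> ->.
- move=> [w [gw fw]] [w' [gw' fw']].
  suff ww' : w = w' by move: fw'; rewrite -ww'; apply: IHf.
  by apply: eq_from_tnth => i; apply: IHg (gw i) (gw' i).
- elim: (thead v) y z => [|x IHx] y z /=; first exact: IHf.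
  move=> [r [xr ry]] [r' [xr' rz]].
  by move: rz; rewrite -(IHx _ _ xr xr'); apply: IHg.
- move=> [fy0 fyS] [fz0 fzS]; case: (ltngtP y z) => // yz.
    by have [r /(IHf _ _ _ fy0)] := fzS _ yz.
  by have [r /(IHf _ _ _ fz0)] := fyS _ yz.
Qed.

(* Streams serve as environments, so that entering a binder shifts the variables
   definitionally; only the first [n] entries are read at arity [n]. *)
Definition computable_at n (F : (nat -> nat) -> nat) : Prop :=
  exists c : recfun n, forall v : n.-tuple nat, eval c v (F (nth 0 v)).

(** Entries beyond the arity read as [0], so every arity makes sense; asking for all of them lets
    closure properties pass under binders, where the arity grows. *)
Definition computable_fun (F : (nat -> nat) -> nat) : Prop :=
  forall n, computable_at n F.

Lemma computable_at_comp m n F (G : 'I_m -> (nat -> nat) -> nat) :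
    computable_at m F -> (forall i, computable_at n (G i)) ->
  computable_at n (fun v => F (nth 0 [tuple G i v | i < m])).
Proof.
move=> [f fP] /choice[g gP]; exists (RComp f g) => v.
by exists [tuple G i (nth 0 v) | i < m]; split=> // i; rewrite tnth_mktuple.
Qed.

Lemma computable_at_ext n F G :
    (forall v : n.-tuple nat, F (nth 0 v) = G (nth 0 v)) ->
  computable_at n F -> computable_at n G.
Proof. by move=> FG [c cP]; exists c => v; rewrite -FG. Qed.

Lemma computable_const k : computable_fun (fun=> k).
Proof.
move=> n; elim: k => [|k [c cP]]; first by exists (RZero n).
exists (RComp RSucc (fun=> c)) => v.
by exists [tuple k | i < 1]; split=> [i|] /=; rewrite ?/thead tnth_mktuple.
Qed.

Lemma computable_var i : computable_fun (fun v => v i).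
Proof.
move=> n; case: (ltnP i n) => [ltin|leni].
  by exists (RProj (Ordinal ltin)) => v /=; rewrite (tnth_nth 0).
apply: computable_at_ext (computable_const 0 n) => v.
by rewrite nth_default ?size_tuple.
Qed.

Lemma computable_comp m F (G : nat -> (nat -> nat) -> nat) :
    computable_fun F -> (forall i, computable_fun (G i)) ->
  computable_fun (fun v => F (fun i => if i < m then G i v else 0)).
Proof.
move=> cF cG n.
apply: computable_at_ext (computable_at_comp (cF m) (fun i : 'I_m => cG i n)) => v.
congr F; apply/funext => i; case: ltnP => [ltim|lemi].
  by rewrite (nth_map (Ordinal ltim)) ?size_enum_ord // nth_enum_ord.
by rewrite nth_default ?size_tuple.
Qed.

Lemma computable_app1 (f : nat -> nat) A :
    computable_fun (fun v => f (v 0)) -> computable_fun A ->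
  computable_fun (fun v => f (A v)).
Proof. by move=> cf cA; apply: (computable_comp 1 cf (fun i => cA)). Qed.

Lemma computable_app2 (f : nat -> nat -> nat) A B :
    computable_fun (fun v => f (v 0) (v 1)) ->
    computable_fun A -> computable_fun B ->
  computable_fun (fun v => f (A v) (B v)).
Proof.
move=> cf cA cB.
by apply: (computable_comp (G := fun i => if i is 0 then A else B) 2 cf); case.
Qed.

Lemma computable_app3 (f : nat -> nat -> nat -> nat) A B C :
    computable_fun (fun v => f (v 0) (v 1) (v 2)) ->
    computable_fun A -> computable_fun B -> computable_fun C ->
  computable_fun (fun v => f (A v) (B v) (C v)).
Proof.
move=> cf cA cB cC.
by apply: (computable_comp (G := fun i => if i is i'.+1 then
   if i' is 0 then B else C else A) 3 cf); case=> // -[].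
Qed.

(** By hypothesis [r i >= n] for [i > n], so at arity [n] the first [n.+1] renamed entries suffice:
    all later ones read [0]. *)
Lemma computable_rename (r : nat -> nat) F : (forall i, i <= (r i).+1) ->
  computable_fun F -> computable_fun (fun v => F (fun i => v (r i))).
Proof.
move=> ler cF n.
apply: computable_at_ext (computable_at_comp (cF n.+1)
  (fun i : 'I_n.+1 => computable_var (r i) n)) => v.
congr F; apply/funext => i; case: (ltnP i n.+1) => [ltin|leni].
  by rewrite (nth_map (Ordinal ltin)) ?size_enum_ord // nth_enum_ord.
by rewrite !nth_default ?size_tuple //; have := ler i; lia.
Qed.

Lemma computable_shift F :
  computable_fun F -> computable_fun (fun v => F (fun i => v i.+1)).
Proof. by apply: (computable_rename (r := succn)) => i; lia. Qed.

Lemma computable_succ A : computable_fun A -> computable_fun (fun v => (A v).+1).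
Proof.
move=> cA n; have [a aP] := cA n; exists (RComp RSucc (fun=> a)) => v.
by exists [tuple A (nth 0 v) | i < 1]; split=> [i|] /=; rewrite ?/thead tnth_mktuple.
Qed.

Lemma computable_rec B (G : nat -> nat -> (nat -> nat) -> nat) N :
    computable_fun B ->
    computable_fun (fun v => G (v 0) (v 1) (fun i => v i.+2)) ->
    computable_fun N ->
  computable_fun
    (fun v => nat_rect (fun=> nat) (B v) (fun i r => G i r v) (N v)).
Proof.
move=> cB cG cN n; have [b bP] := cB n; have [g gP] := cG n.+2.
have [d dP] := cN n.
have recP (v : n.-tuple nat) x : prec_graph (eval b) (eval g) v x
    (nat_rect (fun=> nat) (B (nth 0 v)) (fun i r => G i r (nth 0 v)) x).
  elim: x => [|x IHx] /=; first exact: bP.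
  eexists; split; first exact: IHx.
  exact: (gP [tuple of [:: x, _ & v]]).
(* [RPrec] recurses on its first argument: composition puts the value of [N] there and passes [v] on
   by projections. *)
exists (RComp (RPrec b g) (fun i => if unlift ord0 i is Some j then RProj j else d)).
move=> v; exists [tuple of N (nth 0 v) :: v]; split=> [i|].
  by case: unliftP => [j|] -> /=; [rewrite tnthS|rewrite tnth0; apply: dP].
rewrite /= theadE; suff -> : [tuple of behead [tuple of N (nth 0 v) :: v]] = v by [].
exact: val_inj.
Qed.

Lemma computable_add A B : computable_fun A -> computable_fun B ->
  computable_fun (fun v => A v + B v).
Proof.
move=> cA cB.
have := computable_rec (G := fun _ r _ => r.+1) cB
  (computable_succ (computable_var 1)) cA.
by congr computable_fun; apply/funext => v; elim: (A v) => //= a ->.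
Qed.

Lemma computable_mul A B : computable_fun A -> computable_fun B ->
  computable_fun (fun v => A v * B v).
Proof.
move=> cA cB.
have := computable_rec (G := fun _ r v => B v + r) (computable_const 0)
  (computable_add (computable_shift (computable_shift cB)) (computable_var 1)) cA.
by congr computable_fun; apply/funext => v; elim: (A v) => //= a ->; rewrite mulSn.
Qed.

Lemma computable_sub A B : computable_fun A -> computable_fun B ->
  computable_fun (fun v => A v - B v).
Proof.
move=> cA cB.
have cpred : computable_fun (fun v => (v 0).-1).
  have := computable_rec (G := fun i _ _ => i) (computable_const 0)
    (computable_var 0) (computable_var 0).
  by congr computable_fun; apply/funext => v; case: (v 0).
have := computable_rec (G := fun _ r _ => r.-1) cA
  (computable_app1 cpred (computable_var 1)) cB.
by congr computable_fun; apply/funext => v; elim: (B v) => /= [|b ->]; lia.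
Qed.

(** * Decidable relations and their closure properties *)

Definition decidable_rel (P : (nat -> nat) -> Prop) : Prop :=
  computable_fun (fun v => `[<P v>]).

(** Truncated subtraction [1 - (1 - b)] turns any positive value into [1]; connectives thus reduce
    to arithmetic. *)
Lemma decidable_relE P (b : (nat -> nat) -> nat) :
    (forall v, P v <-> 0 < b v) -> computable_fun b -> decidable_rel P.
Proof.
move=> Pb cb.
have := computable_sub (computable_const 1) (computable_sub (computable_const 1) cb).
congr computable_fun; apply/funext => v.
by case: asboolP => [/Pb|/Pb]; lia.
Qed.

Lemma decidable_leq A B : computable_fun A -> computable_fun B ->
  decidable_rel (fun v => A v <= B v).
Proof.
move=> cA cB; apply: decidable_relE (computable_sub (computable_succ cB) cA).
by move=> v; split; lia.
Qed.

Lemma decidable_not P : decidable_rel P -> decidable_rel (fun v => ~ P v).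
Proof.
move=> dP; apply: decidable_relE (computable_sub (computable_const 1) dP).
by move=> v; case: asboolP.
Qed.

Lemma decidable_and P Q : decidable_rel P -> decidable_rel Q ->
  decidable_rel (fun v => P v /\ Q v).
Proof.
move=> dP dQ; apply: decidable_relE (computable_mul dP dQ) => v.
by case: asboolP => p; case: asboolP => q; split=> // -[].
Qed.

Lemma decidable_ext P Q : (forall v, P v <-> Q v) ->
  decidable_rel P -> decidable_rel Q.
Proof. by move=> PQ; rewrite (_ : P = Q) //; apply/funext => v; apply/propext. Qed.

Lemma decidable_or P Q : decidable_rel P -> decidable_rel Q ->
  decidable_rel (fun v => P v \/ Q v).
Proof.
move=> dP dQ; apply: decidable_relE (computable_add dP dQ) => v.
case: asboolP => p; first by split=> // _; left.
by case: asboolP => q; split=> //; [right|case].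
Qed.

Lemma decidable_imp P Q : decidable_rel P -> decidable_rel Q ->
  decidable_rel (fun v => P v -> Q v).
Proof.
move=> dP dQ; apply: decidable_ext (decidable_or (decidable_not dP) dQ) => v.
by case: (pselect (P v)); tauto.
Qed.

Lemma decidable_eq A B : computable_fun A -> computable_fun B ->
  decidable_rel (fun v => A v = B v).
Proof.
move=> cA cB.
apply: decidable_ext (decidable_and (decidable_leq cA cB) (decidable_leq cB cA)).
by move=> v; split; lia.
Qed.

(** The recursion counts the witnesses below the bound. *)
Lemma decidable_exlt (P : nat -> (nat -> nat) -> Prop) B :
    decidable_rel (fun v => P (v 0) (fun i => v i.+1)) -> computable_fun B ->
  decidable_rel (fun v => exists2 x, x < B v & P x v).
Proof.
move=> dP cB.
have cP : computable_fun (fun v => v 1 + `[<P (v 0) (fun i => v i.+2)>]).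
  apply: computable_add (computable_var 1) _.
  (* The renaming keeps the counter at position [0] and skips the accumulator at position [1]. *)
  by apply: (computable_rename (r := fun i => if i is j.+1 then j.+2 else 0)) dP;
    case=> // i; lia.
have := computable_rec (G := fun i r v => r + `[<P i v>]) (computable_const 0) cP cB.
apply: decidable_relE => v.
elim: (B v) => [|b IHb] /=; first by split=> // -[].
rewrite addn_gt0; split=> [[x]|/orP[/IHb[x ltxb Px]|]].
- rewrite ltnS leq_eqVlt => /predU1P[-> Pb|ltxb Px]; apply/orP.
    by right; case: asboolP.
  by left; apply/IHb; exists x.
- by exists x => //; apply: ltnW.
- by case: asboolP => // Pb _; exists b.
Qed.

Lemma decidable_alllt (P : nat -> (nat -> nat) -> Prop) B :
    decidable_rel (fun v => P (v 0) (fun i => v i.+1)) -> computable_fun B ->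
  decidable_rel (fun v => forall x, x < B v -> P x v).
Proof.
move=> dP cB.
have := decidable_not
  (decidable_exlt (P := fun x v => ~ P x v) (decidable_not dP) cB).
apply: decidable_ext => v; split=> [nP x ltx|aP [x ltx]].
  by apply: contrapT => nPx; apply: nP; exists x.
by case; apply: aP.
Qed.

Lemma decidable_app2 (P : nat -> nat -> Prop) A B :
    decidable_rel (fun v => P (v 0) (v 1)) -> computable_fun A ->
    computable_fun B ->
  decidable_rel (fun v => P (A v) (B v)).
Proof. exact: (computable_app2 (f := fun x y => `[<P x y>])). Qed.

Lemma decidable_app3 (P : nat -> nat -> nat -> Prop) A B C :
    decidable_rel (fun v => P (v 0) (v 1) (v 2)) -> computable_fun A ->
    computable_fun B -> computable_fun C ->
  decidable_rel (fun v => P (A v) (B v) (C v)).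
Proof. exact: (computable_app3 (f := fun x y z => `[<P x y z>])). Qed.

(** * Binary digits *)

Lemma computable_odd A : computable_fun A -> computable_fun (fun v => odd (A v)).
Proof.
move=> cA.
have := computable_rec (G := fun _ r _ => 1 - r) (computable_const 0)
  (computable_sub (computable_const 1) (computable_var 1)) cA.
by congr computable_fun; apply/funext => v; elim: (A v) => //= a ->; case: odd.
Qed.

Lemma computable_half A : computable_fun A -> computable_fun (fun v => (A v)./2).
Proof.
move=> cA.
have := computable_rec (G := fun i r _ => odd i + r) (computable_const 0)
  (computable_add (computable_odd (computable_var 0)) (computable_var 1)) cA.
congr computable_fun; apply/funext => v; elim: (A v) => //= a ->.
by rewrite uphalf_half.
Qed.

(** Lets a number [d] stand for the finite set of positions of its digits [1]. *)
Definition bit k d : bool := odd (iter k half d).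

Lemma decidable_bit A B : computable_fun A -> computable_fun B ->
  decidable_rel (fun v => bit (A v) (B v)).
Proof.
move=> cA cB.
have := computable_odd (computable_rec (G := fun _ r _ => r./2) cB
  (computable_half (computable_var 1)) cA).
apply: decidable_relE => v; rewrite /bit; set a := A v.
suff -> : nat_rect _ (B v) (fun _ r => r./2) a = iter a half (B v) by case: odd.
by elim: a => //= a ->.
Qed.

Lemma bit_leq k d : bit k d -> k < d.
Proof.
rewrite /bit; elim: k d => [|k IHk] d; first by case: d.
by rewrite iterSr => /IHk; lia.
Qed.

Lemma exists_bits (s : seq nat) : exists d, forall k, bit k d = (k \in s).
Proof.
(* Cutting [p] off at [b] allows induction: the lowest digit is [p 0], and the induction hypothesis
   supplies the shifted digits. *)
have bitsP b (p : pred nat) : exists d, forall k, bit k d = (k < b) && p k.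
  elim: b p => [|b IHb] p.
    by exists 0; elim=> // k IHk; rewrite /bit iterSr.
  have [d dP] := IHb (fun k => p k.+1).
  exists (p 0 + d.*2) => -[|k]; first by rewrite /bit /= oddD odd_double addbF oddb.
  by rewrite /bit iterSr half_bit_double; apply: dP.
have [d dP] := bitsP (\max_(i <- s) i).+1 (mem s).
exists d => k; rewrite dP andb_idl // => ks.
by rewrite ltnS (leq_bigmax_seq (F := id) _ ks).
Qed.

(** * Semidecidable relations *)

(** The maximum of finitely many stages serves all [i] at once. This is the compactness that
    exchanges a bounded universal quantifier with an existential one. *)
Lemma uniform_bound b (P : nat -> nat -> Prop) :
    (forall i m n, m <= n -> P i m -> P i n) ->
    (forall i, i < b -> exists n, P i n) ->
  exists n, forall i, i < b -> P i n.
Proof.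
move=> Pmon; elim: b => [|b IHb] Pb; first by exists 0.
have [n nP] := IHb (fun i ltib => Pb i (ltnW ltib)).
have [m mP] := Pb b (ltnSn b).
exists (maxn n m) => i; rewrite ltnS leq_eqVlt => /predU1P[->|/nP].
  by apply: Pmon mP; rewrite leq_maxr.
by apply: Pmon; rewrite leq_maxl.
Qed.

(* [T s] is the set of tuples enumerated by stage [s]. *)
Definition enumeration (P : (nat -> nat) -> Prop)
    (T : nat -> (nat -> nat) -> Prop) : Prop :=
  [/\ decidable_rel (fun v => T (v 0) (fun i => v i.+1)),
      forall s t v, s <= t -> T s v -> T t v &
      forall v, P v <-> exists s, T s v].

Definition semidecidable P : Prop := exists T, enumeration P T.

Lemma semidecidable_ext P Q : (forall v, P v <-> Q v) ->
  semidecidable P -> semidecidable Q.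
Proof. by move=> PQ; rewrite (_ : P = Q) //; apply/funext => v; apply/propext. Qed.

Lemma semidecidable_dec P : decidable_rel P -> semidecidable P.
Proof.
move=> dP; exists (fun=> P); split=> //; first exact: computable_shift dP.
by move=> v; split=> [Pv|[]//]; exists 0.
Qed.

Lemma semidecidable_and P Q : semidecidable P -> semidecidable Q ->
  semidecidable (fun v => P v /\ Q v).
Proof.
move=> [S [dS mS SP]] [T [dT mT TQ]]; exists (fun s v => S s v /\ T s v).
split=> [|s t v st [] /mS-/(_ _ st)? /mT-/(_ _ st)?//|v].
  exact: decidable_and dS dT.
split=> [[/SP[s Ss] /TQ[t Tt]]|[s [Ss Ts]]]; last first.
  by split; [apply/SP|apply/TQ]; exists s.
exists (maxn s t); split; first by apply: mS Ss; apply: leq_maxl.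
by apply: mT Tt; apply: leq_maxr.
Qed.

Lemma semidecidable_or P Q : semidecidable P -> semidecidable Q ->
  semidecidable (fun v => P v \/ Q v).
Proof.
move=> [S [dS mS SP]] [T [dT mT TQ]]; exists (fun s v => S s v \/ T s v).
split=> [|s t v st|v]; first exact: decidable_or dS dT.
  by move=> [/mS-/(_ _ st)|/mT-/(_ _ st)]; [left|right].
split=> [[/SP[s Ss]|/TQ[s Ts]]|[s [Ss|Ts]]]; try by exists s; [left|right].
- by exists s; left.
- by exists s; right.
- by left; apply/SP; exists s.
- by right; apply/TQ; exists s.
Qed.

Definition scons (x : nat) (v : nat -> nat) i : nat := if i is j.+1 then v j else x.

(** A quantifier binds variable [0] and pushes the stage to position [1], whereas [T] expects the
    stage first; the renaming swaps the two. *)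
Lemma decidable_scons T :
    decidable_rel (fun v => T (v 0) (fun i => v i.+1)) ->
  decidable_rel (fun v => T (v 1) (scons (v 0) (fun i => v i.+2))).
Proof.
move=> dT.
have := computable_rename (r := fun i => match i with 0 => 1 | 1 => 0 | _ => i end)
  _ dT.
rewrite /decidable_rel; under eq_fun => v.
  rewrite (_ : (fun i => _) = scons (v 0) (fun i => v i.+2)); last first.
    by apply/funext; case.
  over.
by apply; case=> // -[|i] //; lia.
Qed.

Lemma semidecidable_ex (P : nat -> (nat -> nat) -> Prop) :
    semidecidable (fun v => P (v 0) (fun i => v i.+1)) ->
  semidecidable (fun v => exists x, P x v).
Proof.
move=> [T [dT mT TP]].
(* Dovetailing: stage [s] tries only the witnesses below [s]. *)
exists (fun s v => exists2 x, x < s & T s (scons x v)); split=> [|s t v st|v].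
- apply: (decidable_exlt (P := fun x v => T (v 0) (scons x (fun i => v i.+1)))).
    exact: decidable_scons dT.
  exact: computable_var.
- by move=> [x ltxs Tx]; exists x; [apply: leq_trans st|apply: mT Tx].
split=> [[x Px]|[s [x _ Tx]]]; last by exists x; apply/(TP (scons x v)); exists s.
have [s Ts] := (TP (scons x v)).1 Px.
exists (maxn s x.+1); exists x; first exact: leq_maxr.
by apply: mT Ts; apply: leq_maxl.
Qed.

Lemma semidecidable_alllt (P : nat -> (nat -> nat) -> Prop) B :
    semidecidable (fun v => P (v 0) (fun i => v i.+1)) -> computable_fun B ->
  semidecidable (fun v => forall x, x < B v -> P x v).
Proof.
move=> [T [dT mT TP]] cB.
exists (fun s v => forall x, x < B v -> T s (scons x v)); split=> [|s t v st Ts x|v].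
- apply: (decidable_alllt (P := fun x v => T (v 0) (scons x (fun i => v i.+1)))).
    exact: decidable_scons dT.
  exact: computable_shift cB.
- by move=> /Ts; apply: mT.
split=> [Pv|[s Ts] x /Ts Tx]; last by apply/(TP (scons x v)); exists s.
apply: (uniform_bound (P := fun x s => T s (scons x v))) => [x s t|x /Pv Px].
  exact: mT.
exact/(TP (scons x v)).
Qed.

Lemma semidecidable_case A (P : nat -> (nat -> nat) -> Prop) Q :
    computable_fun A -> semidecidable Q ->
    semidecidable (fun v => P (v 0) (fun i => v i.+1)) ->
  semidecidable (fun v => if A v is n.+1 then P n v else Q v).
Proof.
move=> cA sQ sP.
have := semidecidable_or (semidecidable_and
    (semidecidable_dec (decidable_eq cA (computable_const 0))) sQ)
  (semidecidable_ex (P := fun n v => A v = n.+1 /\ P n v) (semidecidable_and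
    (semidecidable_dec (decidable_eq (computable_shift cA)
      (computable_succ (computable_var 0)))) sP)).
apply: semidecidable_ext => v; case: (A v) => [|n].
  by split=> [[[]//|[n []//]]|Qv]; left.
by split=> [[[]//|[m [[->]]]//]|Pv]; right; exists n.
Qed.

(** A stage might depend on the entries from [2] on; fixing them to [0] leaves a ternary
    relation. *)
Lemma enumeration2 (P : nat -> nat -> Prop) :
    semidecidable (fun v => P (v 0) (v 1)) ->
  exists T : nat -> nat -> nat -> Prop,
    [/\ decidable_rel (fun v => T (v 0) (v 1) (v 2)),
        forall s t x y, s <= t -> T s x y -> T t x y &
        forall x y, P x y <-> exists s, T s x y].
Proof.
move=> [T [dT mT TP]]; exists (fun s x y => T s (scons x (scons y (fun=> 0)))).
split=> [|s t x y|x y]; [|exact: mT|exact: (TP (scons x (scons y _)))].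
have := computable_comp 3 dT computable_var; rewrite /decidable_rel.
congr computable_fun; apply/funext => v /=.
by congr (`[<T _ _>] : nat); apply/funext => -[|[|i]].
Qed.

Lemma semidecidable_app2 (P : nat -> nat -> Prop) A B :
    semidecidable (fun v => P (v 0) (v 1)) ->
    computable_fun A -> computable_fun B ->
  semidecidable (fun v => P (A v) (B v)).
Proof.
move=> /enumeration2[T [dT mT TP]] cA cB.
exists (fun s v => T s (A v) (B v)); split=> [|s t v|v].
- by apply: decidable_app3 dT _ _ _; [apply: computable_var|apply: computable_shift..].
- exact: mT.
- exact: TP.
Qed.

(** Injective but not onto: the code lies between the squares of [a + b] and [a + b + 1], which
    reveals [a + b] and then [a]. *)
Definition cpair a b : nat := (a + b) * (a + b) + a.

Lemma cpair_inj a b c d : cpair a b = cpair c d -> a = c /\ b = d.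
Proof.
rewrite /cpair => E; suff : a + b = c + d by lia.
by case: (ltngtP (a + b) (c + d)) => //; nia.
Qed.

Lemma computable_cpair A B : computable_fun A -> computable_fun B ->
  computable_fun (fun v => cpair (A v) (B v)).
Proof.
move=> cA cB; have cAB := computable_add cA cB.
exact: computable_add (computable_mul cAB cAB) cA.
Qed.

(** * A universal c.e. relation *)

(** The tag [t] selects: [0] zero (also the empty list), [1] successor, [2] projection to entry [f],
    [3] composition, [4] pairing, [5] primitive recursion, [6] unbounded search. *)
Definition code t f g : nat := cpair t (cpair f g).

(** Records that the program [c] maps [x] to [y]. *)
Definition fact c x y : nat := cpair c (cpair x y).

(* [rule M t f g x y] says that the program [code t f g] maps [x] to [y], given
   the computations recorded as facts in [M].  Programs are unary; lists are
   nested pairs ending in [0]. *)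
Definition rule (M : nat -> Prop) t f g x y : Prop :=
  match t with
  | 0 => y = 0
  | 1 => exists a, exists b, x = cpair a b /\ y = a.+1
  | 2 => exists a, exists b, x = cpair a b /\
      match f with
      | i.+1 => M (fact (code 2 i 0) b y)
      | 0 => y = a
      end
  | 3 => exists w, M (fact g x w) /\ M (fact f w y)
  | 4 => exists a, exists b, y = cpair a b /\ (M (fact f x a) /\ M (fact g x b))
  | 5 => exists n, exists u, x = cpair n u /\
      match n with
      | m.+1 => exists z, M (fact (code 5 f g) (cpair m u) z) /\
                          M (fact g (cpair m (cpair z u)) y)
      | 0 => M (fact f u y)
      end
  | 6 => M (fact f (cpair y x) 0) /\
      forall n, n < y -> exists z, M (fact f (cpair n x) z.+1)
  | _ => False
  end.

Definition justified (M : nat -> Prop) k : Prop :=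
  exists t, exists f, exists g, exists x, exists y,
    k = fact (code t f g) x y /\ rule M t f g x y.

(** No order on the list is required: a premise has a smaller program, or the same program and a
    smaller recursion counter, so circular support is impossible. *)
Definition sound (s : seq nat) : Prop :=
  forall k, k \in s -> justified (fun j => j \in s) k.

Definition derivable k : Prop := exists2 s, k \in s & sound s.

Lemma rule_mono (M N : nat -> Prop) t f g x y : (forall k, M k -> N k) ->
  rule M t f g x y -> rule N t f g x y.
Proof.
move=> MN; case: t => [|[|[|[|[|[|[|t]]]]]]] //=.
- by move=> [a [b [-> H]]]; exists a, b; split=> //; case: f H => // i /MN.
- by move=> [w [/MN ? /MN ?]]; exists w.
- by move=> [a [b [-> [/MN ? /MN ?]]]]; exists a, b.
- move=> [n [u [-> H]]]; exists n, u; split=> //.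
  by case: n H => [/MN//|m [z [/MN ? /MN ?]]]; exists z.
- by move=> [/MN ? H]; split=> // n /H[z /MN ?]; exists z.
Qed.

Lemma justified_mono (M N : nat -> Prop) k : (forall k, M k -> N k) ->
  justified M k -> justified N k.
Proof.
by move=> MN [t [f [g [x [y [-> /(rule_mono MN)]]]]]]; exists t, f, g, x, y.
Qed.

Lemma sound_cat s t : sound s -> sound t -> sound (s ++ t).
Proof.
move=> ss st k; rewrite mem_cat => /orP[/ss|/st];
  apply: justified_mono => j; rewrite mem_cat => -> //; exact: orbT.
Qed.

Lemma rule_finite t f g x y : rule derivable t f g x y ->
  exists2 s, sound s & rule (fun k => k \in s) t f g x y.
Proof.
have nilP : sound [::] by [].
case: t => [|[|[|[|[|[|[|t]]]]]]] //=; try by exists [::].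
- move=> [a [b [-> H]]]; case: f H => [->|i [s si ss]].
    by exists [::] => //; exists a, b.
  by exists s => //; exists a, b.
- move=> [w [[s ws ss] [t wt st]]]; exists (s ++ t); first exact: sound_cat.
  by exists w; rewrite !mem_cat ws wt orbT.
- move=> [a [b [-> [[s ws ss] [t wt st]]]]]; exists (s ++ t); first exact: sound_cat.
  by exists a, b; rewrite !mem_cat ws wt orbT.
- move=> [[|n] [u [-> ]]] => [[s us ss]|[z [[s ws ss] [t wt st]]]].
    by exists s => //; exists 0, u.
  exists (s ++ t); first exact: sound_cat.
  by exists n.+1, u; split=> //; exists z; rewrite !mem_cat ws wt orbT.
move=> [[s ys ss]].
(* The search rule has one premise for each [n < y]; their supports are concatenated by induction on
   the bound. *)
suff H m : (forall n, n < m -> exists z, derivable (fact f (cpair n x) z.+1)) ->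
    exists2 s, sound s & forall n, n < m -> exists z, fact f (cpair n x) z.+1 \in s.
  move=> /H[r sr rP]; exists (s ++ r); first exact: sound_cat.
  rewrite mem_cat ys; split=> // n /rP[z zr].
  by exists z; rewrite mem_cat zr orbT.
elim: m => [|m IHm] mP; first by exists [::].
have [|r sr rP] := IHm; first by move=> n ltnm; apply: mP; apply: ltnW.
have [z [t zt st]] := mP m (ltnSn m).
exists (r ++ t) => [|n]; first exact: sound_cat.
rewrite ltnS leq_eqVlt => /predU1P[->|/rP[w wr]].
  by exists z; rewrite mem_cat zt orbT.
by exists w; rewrite mem_cat wr.
Qed.

Lemma fact_inj t f g x y t' f' g' x' y' :
    fact (code t f g) x y = fact (code t' f' g') x' y' ->
  [/\ t = t', f = f', g = g', x = x' & y = y'].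
Proof.
by move=> /cpair_inj[/cpair_inj[-> /cpair_inj[-> ->]] /cpair_inj[-> ->]].
Qed.

(** Inversion holds because a supporting list is sound; conversely, the new fact is put in front of
    a list supporting its finitely many premises. *)
Lemma derivableE t f g x y :
  derivable (fact (code t f g) x y) <-> rule derivable t f g x y.
Proof.
split=> [[s ks ss]|/rule_finite[s ss sP]].
  have [t' [f' [g' [x' [y' [/fact_inj[-> -> -> -> ->] H]]]]]] := ss _ ks.
  by apply: rule_mono H => j js; exists s.
exists (fact (code t f g) x y :: s); first exact: mem_head.
have sub k : k \in s -> k \in fact (code t f g) x y :: s.
  by rewrite inE orbC => ->.
move=> k; rewrite inE => /predU1P[->|/ss]; last exact: justified_mono.
by exists t, f, g, x, y; split=> //; apply: rule_mono sP.
Qed.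

Definition seq_code (s : seq nat) : nat := foldr cpair 0 s.

Lemma derivable_proj s i y : i < size s ->
  derivable (fact (code 2 i 0) (seq_code s) y) <-> y = nth 0 s i.
Proof.
elim: i s => [|i IHi] [//|x s] /= ltis; rewrite derivableE /=.
  split=> [[a [b [/cpair_inj[-> _]]]]//|->].
  by exists x, (seq_code s).
split=> [[a [b [/cpair_inj[_ <-] /(IHi s ltis)]]]//|/(IHi s ltis)].
by exists x, (seq_code s).
Qed.

(** Folding the pairing program over [js] collects the results in a list, which becomes the argument
    list of a composition. *)
Lemma derivable_list js x w :
  derivable (fact (foldr (code 4) (code 0 0 0) js) x w) <->
  exists ws, [/\ w = seq_code ws, size ws = size js &
    forall i, i < size js -> derivable (fact (nth 0 js i) x (nth 0 ws i))].
Proof.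
elim: js w => [|j js IHjs] w /=; rewrite derivableE /=.
  by split=> [->|[[|? ?] [->]]]; first by exists [::].
split=> [[a [b [-> [da /IHjs[ws [-> sz wsP]]]]]]|].
  by exists (a :: ws); split=> //=; [rewrite sz|case].
move=> [[|a ws] [-> //= [sz] wsP]].
exists a, (seq_code ws); split=> //; split; first exact: (wsP 0).
by apply/IHjs; exists ws; split=> // i; apply: (wsP i.+1).
Qed.

Lemma eval_derivable n (c : recfun n) : exists j, forall (v : n.-tuple nat) y,
  eval c v y <-> derivable (fact j (seq_code v) y).
Proof.
elim: c => {n} [n|||m n f [jf jfP] g|n f [jf jfP] g [jg jgP]|n f [jf jfP]].
- by exists (code 0 0 0) => v y; rewrite derivableE.
- exists (code 1 0 0) => v y; case/tupleP: v => x v.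
  rewrite derivableE /= theadE; split=> [->|[a [b [/cpair_inj[-> _]]]]//].
  by exists x, (seq_code v).
- move=> n i; exists (code 2 i 0) => v y.
  by rewrite derivable_proj ?size_tuple // -tnth_nth.
- move=> /choice[G GP].
  exists (code 3 jf (foldr (code 4) (code 0 0 0) [seq G i | i <- enum 'I_m])) => v y.
  have szG : size [seq G i | i <- enum 'I_m] = m by rewrite size_map size_enum_ord.
  have nthG (i : 'I_m) : nth 0 [seq G i | i <- enum 'I_m] i = G i.
    by rewrite (nth_map i) ?size_enum_ord // nth_ord_enum.
  rewrite derivableE /=; split=> [[w [gw /jfP fw]]|[w []]].
    exists (seq_code w); split=> //; apply/derivable_list; exists w.
    rewrite szG size_tuple; split=> // i ltim.
    have /GP := gw (Ordinal ltim); rewrite (tnth_nth 0).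
    by rewrite -(nthG (Ordinal ltim)).
  move=> /derivable_list[ws [-> sz wsP]] fy; rewrite szG in sz wsP.
  pose u : m.-tuple nat := tcast sz (in_tuple ws).
  have wE : ws = u by rewrite val_tcast.
  exists u; split=> [i|]; last by apply/jfP; rewrite -wE.
  by apply/GP; rewrite (tnth_nth 0) -nthG -wE; apply: wsP.
- exists (code 5 jf jg) => v y; case/tupleP: v => x v.
  have vE : [tuple of behead [tuple of x :: v]] = v by apply: val_inj.
  rewrite /= theadE vE {vE}.
  elim: x y => [|x IHx] y; rewrite derivableE /=.
    rewrite jfP; split=> [H|[n' [u [/cpair_inj[<- <-]]]]//].
    by exists 0, (seq_code v).
  split=> [[z [/IHx dz /jgP dy]]|[n' [u [/cpair_inj[<- <-] [z [/IHx dz dy]]]]]].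
    by exists x.+1, (seq_code v); split=> //; exists z.
  by exists z; split=> //; apply/jgP.
exists (code 6 jf 0) => v y; rewrite derivableE /=.
split=> -[fy H]; split; [|move=> x /H[z]| |move=> x /H[z]].
- exact/(jfP [tuple of y :: v]).
- by move=> /(jfP [tuple of x :: v]) ?; exists z.
- exact/(jfP [tuple of y :: v]).
- by move=> ?; exists z; apply/(jfP [tuple of x :: v]).
Qed.

Lemma computable_fact A B C : computable_fun A -> computable_fun B ->
  computable_fun C -> computable_fun (fun v => fact (A v) (B v) (C v)).
Proof.
by move=> cA cB cC; apply: computable_cpair cA (computable_cpair cB cC).
Qed.

Ltac computability := repeat first
  [ apply: computable_const | apply: computable_var
  | apply: computable_fact | apply: computable_cpair | apply: computable_succ
  | apply: semidecidable_ex | apply: semidecidable_and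
  | apply: semidecidable_or | apply: semidecidable_case
  | apply: semidecidable_alllt
  | apply: semidecidable_dec | apply: decidable_eq | apply: decidable_bit
  | apply: decidable_not ]; cbv beta.

(** A supporting list is searched for as the digit set of a number [d]. Its members are below [d],
    and membership is decidable, so all other quantifiers are bounded or existential. *)
Lemma semidecidable_derivable : semidecidable (fun v => derivable (v 0)).
Proof.
apply: (semidecidable_ext (P := fun v => exists d, bit (v 0) d /\
    forall k, k < d -> ~ bit k d \/ justified (fun j => bit j d) k)).
  move=> v; split=> [[d [vd dP]]|[s vs ss]].
    exists [seq k <- iota 0 d | bit k d].
      by rewrite mem_filter mem_iota vd bit_leq.
    move=> k; rewrite mem_filter mem_iota => /andP[kd /dP[//|]].
    by apply: justified_mono => j jd; rewrite mem_filter mem_iota jd bit_leq.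
  have [d dP] := exists_bits s; exists d; rewrite dP; split=> // k _.
  rewrite dP; case: (boolP (k \in s)) => [/ss ks|]; [right|by left].
  by apply: justified_mono ks => j; rewrite dP.
rewrite /justified /rule /code.
by computability.
Qed.

(** [U i x] says that program [i] halts on the one-entry list of [x]. *)
Lemma universal_ce_rel : exists U : nat -> nat -> Prop,
  semidecidable (fun v => U (v 0) (v 1)) /\
  forall W, ce_set W -> exists i, forall x, W x <-> U i x.
Proof.
exists (fun i x => exists y, derivable (fact i (cpair x 0) y)); split.
  apply: semidecidable_ex.
  apply: (semidecidable_app2 (P := fun k _ => derivable k) (B := fun=> 0)).
  - exact: semidecidable_derivable.
  - by computability.
  - by computability.
move=> W [phi [[c cP] ->]]; have [i iP] := eval_derivable c.
exists i => x; split=> -[y H]; exists y; first exact/(iP [tuple x])/cP.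
exact/cP/(iP [tuple x]).
Qed.

(** * Pi_2 cohesive subsets of infinite Pi_1 sets *)

(* The number with binary digits [V 0 x], ..., [V e.-1 x], the most significant
   one first: comparing states is comparing these sequences lexicographically. *)
Fixpoint state (V : nat -> nat -> Prop) e x : nat :=
  if e is e'.+1 then (state V e' x).*2 + `[<V e' x>] else 0.

(** Dropping the last digit is halving, which is monotone. *)
Lemma state_prefix V V' k e x y : k <= e ->
  state V e x <= state V' e y -> state V k x <= state V' k y.
Proof.
elim: e => [|e IHe]; first by rewrite leqn0 => /eqP->.
rewrite leq_eqVlt => /predU1P[->//|/IHe{}IHe] /= le_xy; apply: IHe; lia.
Qed.

Lemma state_bit V j k x y : j < k -> state V k x = state V k y -> V j x <-> V j y.
Proof.
elim: k => // k IHk; rewrite ltnS leq_eqVlt => jk /= eq_xy.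
have [eqst eqb] : state V k x = state V k y /\ `[<V k x>] = `[<V k y>].
  by move: eq_xy; do 2!case: `[<_>]; lia.
case/predU1P: jk => [->|ltjk]; last exact: IHk.
exact: asbool_eq_equiv.
Qed.

Lemma state_ub V e x : state V e x < 2 ^ e.
Proof. by elim: e => //= e IHe; rewrite expnS; case: `[<_>]; lia. Qed.

Lemma state_mono V V' e x : (forall j, V j x -> V' j x) ->
  state V e x <= state V' e x.
Proof.
move=> VV'; elim: e => //= e IHe; apply: leq_add; first by rewrite leq_double.
by case: asboolP => // /VV' V'x; case: asboolP.
Qed.

Lemma state_stage V T e x : (forall s t j, s <= t -> T s j x -> T t j x) ->
    (forall j, V j x <-> exists s, T s j x) ->
  exists s, state (T s) e x = state V e x.
Proof.
move=> Tmon TV; elim: e => [|e [s IHe]]; first by exists 0.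
(* The digit [e] is correct from the stage that enumerates [x], or from the start if none does. *)
have [t tP] : exists t, forall m, t <= m -> T m e x <-> V e x.
  case: (pselect (V e x)) => [Vx|nVx]; last first.
    by exists 0 => m _; split=> // Tx; apply/TV; exists m.
  have [t Tx] := (TV e).1 Vx; exists t => m le_tm; split=> // _.
  exact: Tmon Tx.
exists (maxn s t) => /=; congr (_.*2 + _); last first.
  by congr nat_of_bool; apply: asbool_equiv_eq; apply: tP; rewrite leq_maxr.
apply/eqP; rewrite eqn_leq -{2}IHe !state_mono // => j Tj.
  by apply: Tmon Tj; rewrite leq_maxl.
by apply/TV; exists (maxn s t).
Qed.

Lemma computable_state T S E X :
    decidable_rel (fun v => T (v 0) (v 1) (v 2)) -> computable_fun S ->
    computable_fun E -> computable_fun X ->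
  computable_fun (fun v => state (T (S v)) (E v) (X v)).
Proof.
move=> dT cS cE cX.
have shift2 F : computable_fun F -> computable_fun (fun v => F (fun i => v i.+2)).
  by move=> cF; do 2!apply: (computable_shift (F := fun v => _ (fun i => v _))).
have := computable_rec (G := fun i r v => r + r + `[<T (S v) i (X v)>])
  (computable_const 0) (computable_add
    (computable_add (computable_var 1) (computable_var 1))
    (decidable_app3 dT (shift2 _ cS) (computable_var 0) (shift2 _ cX))) cE.
congr computable_fun; apply/funext => v.
by elim: (E v) => //= e ->; rewrite addnn.
Qed.

Lemma finite_natP (A : set nat) :
  finite_set A <-> exists n, forall x, A x -> x < n.
Proof.
split=> [/finite_seqP[s ->]|[n nP]]; last first.
  by apply: sub_finite_set (finite_II n) => x /nP.
exists (\max_(i <- s) i).+1 => x /= xs.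
by rewrite ltnS (leq_bigmax_seq (F := id) _ xs).
Qed.

Lemma infinite_natP (A : set nat) :
  infinite_set A <-> forall n, exists2 x, n <= x & A x.
Proof.
split=> [infA n|Aub /finite_natP[n nP]]; last first.
  by have [x le_nx /nP] := Aub n; rewrite ltnNge le_nx.
apply: contrapT => nA; apply: infA; apply/finite_natP; exists n => x Ax.
by rewrite ltnNge; apply/negP => le_nx; apply: nA; exists x.
Qed.

Lemma almost_subsetP (X Y : set nat) :
  almost_subset X Y <-> exists n, forall x, n <= x -> X x -> Y x.
Proof.
rewrite /almost_subset finite_natP; split=> -[n nP]; exists n => x.
  move=> le_nx Xx; apply: contrapT => nYx.
  by have := nP x (conj Xx nYx); rewrite ltnNge le_nx.
by move=> [Xx nYx]; rewrite ltnNge; apply/negP => /nP-/(_ Xx).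
Qed.

Lemma least_nat (P : nat -> Prop) : (exists n, P n) ->
  exists2 n, P n & forall m, P m -> n <= m.
Proof.
move=> [n Pn]; have exP : exists n, `[<P n>] by exists n; apply/asboolP.
case: (ex_minnP exP) => m /asboolP Pm mP; exists m => // k Pk.
by apply: mP; apply/asboolP.
Qed.

(** [N] minimises the distance from [f N] to the bound. *)
Lemma bounded_nondecreasing_stationary (f : nat -> nat) b :
    (forall m n, m <= n -> f m <= f n) -> (forall n, f n < b) ->
  exists N, forall n, N <= n -> f n = f N.
Proof.
move=> fmon fb; have [|d [N dE] dP] := @least_nat (fun d => exists N, d = b - f N).
  by exists (b - f 0), 0.
exists N => n leNn; have := dP _ (ex_intro _ n erefl).
by have := fmon _ _ leNn; have := fb n; have := fb N; lia.
Qed.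

(* [x] is the least element of minimal state among the numbers [>= e]. *)
Definition selected V e x : Prop :=
  e <= x /\ forall y, e <= y -> state V e.+1 x + (y < x) <= state V e.+1 y.

Lemma exists_selected V e : exists x, selected V e x.
Proof.
(* First the least state, then the least number attaining it; the summand [y < x] in [selected]
   makes the inequality strict below [x]. *)
have [|m [z [lez mE]] mP] :=
    @least_nat (fun m => exists z, e <= z /\ m = state V e.+1 z).
  by exists (state V e.+1 e), e.
have [|x [lex xm] xP] := @least_nat (fun x => e <= x /\ state V e.+1 x = m).
  by exists z.
exists x; split=> // y ley; have := mP _ (ex_intro _ y (conj ley erefl)).
rewrite xm leq_eqVlt => /predU1P[my|]; last by lia.
by have := xP y (conj ley (esym my)); lia.
Qed.

Lemma selected_uniq V e x y : selected V e x -> selected V e y -> x = y.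
Proof.
move=> [ex xP] [ey yP]; have := xP y ey; have := yP x ex; lia.
Qed.

Definition selection V : set nat := [set x | exists e, selected V e x].

Lemma infinite_selection V : infinite_set (selection V).
Proof.
apply/infinite_natP => n; have [x xP] := exists_selected V n.
by exists x; [case: xP|exists n].
Qed.

Lemma selection_decides V j :
  almost_subset (selection V) (V j) \/ almost_subset (selection V) (~` V j).
Proof.
have /choice[c cP] := exists_selected V.
(* The shift by [j] ensures that the choice of [c (e + j)] takes [V 0], ..., [V j] into account. The
   state on these cannot decrease, as the candidates only shrink. *)
have [|n|N NP] := @bounded_nondecreasing_stationary
    (fun e => state V j.+1 (c (e + j))) (2 ^ j.+1).
- move=> m n le_mn; apply: (@state_prefix _ _ _ (m + j).+1); first by lia.
  have [_ /(_ (c (n + j)))] := cP (m + j); have [] := cP (n + j); lia.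
- exact: state_ub.
(* A selected number above all [c i] with [i < N + j] is some [c e] with [N + j <= e]. *)
have VN x : (\max_(i < N + j) c i).+1 <= x -> selection V x ->
    V j x <-> V j (c (N + j)).
  move=> ltx [e ex]; have xE : x = c e := selected_uniq ex (cP e).
  have leNe : N + j <= e.
    rewrite leqNgt; apply/negP => lteN.
    have := leq_bigmax (F := fun i : 'I_(N + j) => c i) (Ordinal lteN).
    by rewrite -xE leqNgt ltx.
  apply: (@state_bit _ _ j.+1) => //; rewrite -(NP (e - j)); last by lia.
  by rewrite xE subnK //; lia.
case: (pselect (V j (c (N + j)))) => VjN; [left|right];
  apply/almost_subsetP; exists (\max_(i < N + j) c i).+1 => x lex Cx.
  exact/(VN x lex Cx).
by move=> /(VN x lex Cx).
Qed.

(** Some [y >= e] has leading digit [0], so minimality forces this digit on the selected number. *)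
Lemma selection_zero V : infinite_set (~` V 0) -> selection V `<=` ~` V 0.
Proof.
move=> /infinite_natP infV x [e [_ xP]] V0x.
have [y ley V0y] := infV e.
have := @state_prefix V V 1 e.+1 x y isT (leq_trans (leq_addr _ _) (xP y ley)).
by rewrite /=; case: asboolP => // _; case: asboolP.
Qed.

Lemma Pi2_selection V : semidecidable (fun v => V (v 0) (v 1)) ->
  Pi2_set (selection V).
Proof.
move=> /enumeration2[T [dT mT TV]].
(* The test of [selected] for some [e <= x], with [y] below [n], the state of [x] at stage [n] and
   that of [y] at stage [m]. States grow with the stage, so a larger [n] strengthens the condition
   and a larger [m] weakens it. *)
pose R x n m := exists2 e, e < x.+1 & forall y, y < n -> e <= y ->
  state (T n) e.+1 x + (y < x) <= state (T m) e.+1 y.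
exists R; split.
  have dR : decidable_rel (fun v => R (v 0) (v 1) (v 2)).
    apply: decidable_exlt; last by computability.
    apply: decidable_alllt; last by computability.
    apply: decidable_imp; first by apply: decidable_leq; computability.
    apply: decidable_leq; last by apply: computable_state dT _ _ _; computability.
    apply: computable_add; first by apply: computable_state dT _ _ _; computability.
    have := decidable_leq (computable_succ (computable_var 0)) (computable_var 2).
    by congr computable_fun; apply/funext => v; rewrite asboolb.
  have [c cP] := dR 3; exists c => x y z.
  by split=> H; move: (cP [tuple x; y; z]) => /=; case: asboolP.
have Tmon e x n m : n <= m -> state (T n) e x <= state (T m) e x.
  by move=> le_nm; apply: state_mono => j; apply: mT.
have TleV e x n : state (T n) e x <= state V e x.
  by apply: state_mono => j Tj; apply/TV; exists n.
have Tlim e x : exists n, state (T n) e x = state V e x.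
  by apply: state_stage => // s t j; apply: mT.
move=> x; split=> [[e [lex xP]] n|RP].
  (* A stage [m] at which the states of all [y < n] have reached their limits. *)
  have [|m mP] := @uniform_bound n
      (fun y m => state (T m) e.+1 y = state V e.+1 y) _ (fun y _ => Tlim e.+1 y).
    move=> y i k leik ikE; apply/eqP; rewrite eqn_leq TleV -{1}ikE.
    exact: Tmon.
  exists m; exists e => // y /mP-> ley; apply: leq_trans (xP y ley).
  by rewrite leq_add2r.
apply: contrapT => nsel.
(* Compactness: each of the finitely many [e <= x] fails at some [n], and failure persists for
   larger [n], so one [n] refutes them all. *)
have [n nP] : exists n, forall e, e < x.+1 ->
    ~ exists m, forall y, y < n -> e <= y ->
    state (T n) e.+1 x + (y < x) <= state (T m) e.+1 y.
  apply: uniform_bound => [e i n le_in nP [m mP]|e ltex].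
    apply: nP; exists m => y lty ley; apply: leq_trans (mP y _ ley).
      by rewrite leq_add2r Tmon.
    exact: leq_trans le_in.
  apply: contrapT => Pn; apply: nsel; exists e; split=> // y ley.
  have [k kP] := Tlim e.+1 x.
  (* [k] makes the state of [x] exact, and [y.+1] brings [y] below the bound. *)
  have [m mP] := contrapT (fun nm => Pn (ex_intro _ (maxn k y.+1) nm)).
  apply: leq_trans (TleV _ _ m); apply: leq_trans (mP y _ ley).
    by rewrite leq_add2r -kP Tmon ?leq_maxl.
  by rewrite leq_maxr.
by have [m [e ltex mP]] := RP n; apply: (nP e ltex); exists m.
Qed.

Lemma Pi2_cohesive_subset (A : set nat) :
    infinite_set A -> semidecidable (fun v => ~ A (v 0)) ->
  exists C, [/\ C `<=` A, Pi2_set C & cohesive C].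
Proof.
move=> infA sA; have [U [sU UP]] := universal_ce_rel.
(* The complement of [A] comes first, as the most significant digit. *)
pose V j : set nat := if j is i.+1 then U i else ~` A.
exists (selection V); split.
- move=> x /(@selection_zero V) /= nnA; apply: contrapT; apply: nnA.
  by rewrite setCK.
- apply: Pi2_selection.
  apply: (semidecidable_ext
    (P := fun v => if v 0 is i.+1 then U i (v 1) else ~ A (v 1))).
    by move=> v; case: (v 0).
  apply: semidecidable_case; first by computability.
    apply: (semidecidable_app2 (P := fun x _ => ~ A x) (B := fun=> 0)) sA _ _;
      by computability.
  by apply: semidecidable_app2 sU _ _; computability.
split; first exact: infinite_selection.
move=> W /UP[i iP]; rewrite (_ : W = V i.+1); first exact: selection_decides.
by apply/seteqP; split=> x /iP.
Qed.

(** * Cohesive powers *)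

Lemma partial_computable_total (f : nat -> nat) :
  computable_fun (fun v => f (v 0)) -> partial_computable (fun x => Some (f x)).
Proof.
move=> /(_ 1)[c cP]; exists c => x y; have cx := cP [tuple x].
by split=> [[<-]//|/(eval_inj cx) <-].
Qed.

Lemma computable_fun_at m F :
    (forall v w, (forall i, i < m -> v i = w i) -> F v = F w) ->
  computable_at m F -> computable_fun F.
Proof.
move=> Fm cF n.
apply: computable_at_ext
  (computable_at_comp cF (fun i : 'I_m => computable_var i n)) => v.
apply: Fm => i ltim.
by rewrite (nth_map (Ordinal ltim)) ?size_enum_ord // nth_enum_ord.
Qed.

Lemma decidable_set (L : set nat) :
  computable_set L -> decidable_rel (fun v => L (v 0)).
Proof.
move=> [c cP]; apply: (@computable_fun_at 1) => [v w vw|]; first by rewrite vw.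
exists c => v; case/tupleP: v => x v; rewrite (tuple0 v) /=.
by have [H0 H1] := cP x; case: asboolP.
Qed.

Lemma decidable_rel2 (R : nat -> nat -> Prop) :
  computable_rel2 R -> decidable_rel (fun v => R (v 0) (v 1)).
Proof.
move=> [c cP]; apply: (@computable_fun_at 2) => [v w vw|]; first by rewrite !vw.
exists c => v; case/tupleP: v => x v; case/tupleP: v => y v; rewrite (tuple0 v) /=.
rewrite (_ : [tuple of _] = [tuple x; y]); last exact: val_inj.
by have [H0 H1] := cP x y; case: asboolP.
Qed.

Lemma decidable_app1 (P : nat -> Prop) A :
    decidable_rel (fun v => P (v 0)) -> computable_fun A ->
  decidable_rel (fun v => P (A v)).
Proof. exact: (computable_app1 (f := fun x => `[<P x>])). Qed.

(** Bounded search made total: [d] is the value if no [i < n] satisfies [Q]. *)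
Definition last_sat (Q : nat -> Prop) d n : nat :=
  nat_rect (fun=> nat) d (fun i r => if `[<Q i>] then i else r) n.

Lemma last_satP Q d n (P : nat -> Prop) :
  P d -> (forall i, Q i -> P i) -> P (last_sat Q d n).
Proof. by move=> Pd QP; elim: n => //= n IHn; case: asboolP => // /QP. Qed.

Lemma last_sat_uniq Q d n a : a < n -> Q a -> (forall i, Q i -> i = a) ->
  last_sat Q d n = a.
Proof.
move=> + Qa Qu; elim: n => // n IHn; rewrite ltnS leq_eqVlt /=.
case: asboolP => [/Qu//|nQ] /predU1P[an|/IHn//].
by case: nQ; rewrite -an.
Qed.

Lemma computable_last_sat (Q : nat -> (nat -> nat) -> Prop) d N :
    decidable_rel (fun v => Q (v 0) (fun i => v i.+1)) -> computable_fun N ->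
  computable_fun (fun v => last_sat (fun i => Q i v) d (N v)).
Proof.
move=> dQ cN.
have dQ' : computable_fun (fun v => `[<Q (v 0) (fun i => v i.+2)>]).
  by apply: (computable_rename (r := fun i => if i is j.+1 then j.+2 else 0)) dQ;
    case=> // i; lia.
have := computable_rec (G := fun i r v => `[<Q i v>] * i + (1 - `[<Q i v>]) * r)
  (computable_const d) (computable_add (computable_mul dQ' (computable_var 0))
    (computable_mul (computable_sub (computable_const 1) dQ')
      (computable_var 1))) cN.
congr computable_fun; apply/funext => v; rewrite /last_sat; congr nat_rect.
by apply/funext => i; apply/funext => r; case: `[<_>]; lia.
Qed.

Lemma almost_subset_sub X Y (Z : set nat) :
  (forall x, Y x -> Z x) -> almost_subset X Y -> almost_subset X Z.
Proof.
move=> YZ /almost_subsetP[n nP]; apply/almost_subsetP; exists n => x le_nx Xx.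
exact/YZ/nP.
Qed.

Lemma almost_subsetI (X Y Z : set nat) :
  almost_subset X Y -> almost_subset X Z -> almost_subset X (Y `&` Z).
Proof.
move=> /almost_subsetP[n nP] /almost_subsetP[m mP]; apply/almost_subsetP.
exists (maxn n m) => x; rewrite geq_max => /andP[le_nx le_mx] Xx.
by split; [apply: nP|apply: mP].
Qed.

Lemma power_class_refl L C phi : power_fun L C phi -> power_class L C phi phi.
Proof.
move=> phiP; split=> //; have [_ _] := phiP.
by apply: almost_subset_sub => x [y xy]; exists y.
Qed.

(** Other representatives agree with the given ones at all but finitely many points of [C]. *)
Lemma power_ltE L lt C phi psi : power_fun L C phi -> power_fun L C psi ->
  power_lt lt C (power_class L C phi) (power_class L C psi) <->
  almost_subset C [set n | exists x y,
    [/\ phi n = Some x, psi n = Some y & lt x y]].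
Proof.
move=> phiP psiP; split; last first.
  by move=> H; exists phi, psi; split=> //; apply: power_class_refl.
move=> [phi' [psi' [[_ eq1] [_ eq2] lt12]]].
apply: almost_subset_sub (almost_subsetI (almost_subsetI eq1 eq2) lt12).
move=> n [[[x [px p'x]] [y [qy q'y]]] [x' [y' [p'x' q'y' ltxy]]]].
move: p'x q'y; rewrite p'x' q'y' => -[ex] [ey]; exists x', y'.
by rewrite ex ey in ltxy *.
Qed.

(* [K] has infinitely many predecessors, so it is not sent into
   [omega]; having an immediate successor, it is not sent into [eta] either. *)
Lemma adjacent_not_omega_plus_eta (D : set (set pfun)) R K H (u : nat -> set pfun) :
    D K -> D H -> R K H -> ~ (exists Z, [/\ D Z, R K Z & R Z H]) ->
    (forall i, D (u i) /\ R (u i) K) -> (forall i, R (u i) (u i.+1)) ->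
  ~ order_iso D R [set: nat + rat] omega_plus_eta_lt.
Proof.
move=> DK DH KH nKZH uP uS [f [[_ _ fsurj] fR]].
case fK : (f K) => [k|q].
  have /choice[w wP] i : exists m, f (u i) = inl m /\ m < k.
    have [Du uK] := uP i; move: ((fR _ _ Du DK).1 uK); rewrite fK.
    by case: (f (u i)) => //= m mk; exists m.
  have wS i : w i < w i.+1.
    move: ((fR _ _ (uP i).1 (uP i.+1).1).1 (uS i)).
    by have [-> _] := wP i; have [-> _] := wP i.+1.
  (* An increasing sequence of naturals cannot stay below [k]: its term of index [k] is at least
     [k]. *)
  have wge i : i <= w i by elim: i => // i IHi; apply: leq_ltn_trans IHi (wS i).
  by have [_] := wP k; rewrite ltnNge wge.
have := (fR _ _ DK DH).1 KH; rewrite fK; case fH : (f H) => [//|r] /= qr.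
have [Z DZ fZ] := fsurj (inr ((q + r) / 2%:R)%R) I.
apply: nKZH; exists Z; split=> //; [apply/(fR _ _ DK DZ)|apply/(fR _ _ DZ DH)].
  by rewrite fK fZ /=; apply: (Num.Theory.midf_lt qr).1.
by rewrite fH fZ /=; apply: (Num.Theory.midf_lt qr).2.
Qed.

Lemma omega_enumeration (L : set nat) lt :
    order_iso L lt [set: nat] (fun m n => m < n) ->
  exists h : nat -> nat, [/\ forall n, L (h n), forall x, L x -> exists n, x = h n &
    forall m n, lt (h m) (h n) <-> m < n].
Proof.
move=> [g [[_ ginj gsurj] gP]].
have /choice[h hP] n : exists x, L x /\ g x = n by have [x] := gsurj n I; exists x.
exists h; split=> [n|x Lx|m n]; first by have [] := hP n.
  exists (g x); have [Lh gh] := hP (g x).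
  by apply: ginj; rewrite ?inE.
have [Lm gm] := hP m; have [Ln gn] := hP n.
by rewrite gP // gm gn.
Qed.

Theorem proposition4p3 (L : set nat) (lt : nat -> nat -> Prop)
    (omega_L : computable_copy_of_omega L lt) :
  exists C : set nat,
    [/\ Pi2_set C, cohesive C &
        ~ order_iso (power_dom L C) (power_lt lt C)
            [set: nat + rat] omega_plus_eta_lt].
Proof.
have [[_ /decidable_set dL ltL /decidable_rel2 dlt _] /omega_enumeration] := omega_L.
move=> [h [Lh hsurj hlt]].
have hinj m n : h m = h n -> m = n.
  by move=> hmn; case: (ltngtP m n) => // /hlt; rewrite hmn => /hlt; rewrite ltnn.
(* Components of a pair are at most its code, so a search below [p.+1] finds them. If [p] codes no
   pair from [L], the default [h 0] keeps [phi] and [psi] total with values in [L]. *)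
pose fst_rel p a := exists2 b, b < p.+1 & L a /\ (L b /\ p = cpair a b).
pose snd_rel p b := exists2 a, a < p.+1 & L a /\ (L b /\ p = cpair a b).
pose phi p := last_sat (fst_rel p) (h 0) p.+1.
pose psi p := last_sat (snd_rel p) (h 0) p.+1.
have cphi : computable_fun (fun v => phi (v 0)).
  apply: (computable_last_sat (Q := fun a v => fst_rel (v 0) a));
    last by computability.
  apply: decidable_exlt; last by computability.
  by do !apply: decidable_and;
    first [apply: decidable_app1 dL _|apply: decidable_eq]; computability.
have cpsi : computable_fun (fun v => psi (v 0)).
  apply: (computable_last_sat (Q := fun a v => snd_rel (v 0) a));
    last by computability.
  apply: decidable_exlt; last by computability.
  by do !apply: decidable_and;
    first [apply: decidable_app1 dL _|apply: decidable_eq]; computability.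
have Lphi p : L (phi p) by apply: last_satP => // a [b _ []].
have Lpsi p : L (psi p) by apply: last_satP => // b [a _ [_ []]].
have phiE a b : L a -> L b -> phi (cpair a b) = a.
  move=> La Lb; apply: last_sat_uniq => [||i [j _ [_ [_ /cpair_inj[]]]]//].
    by rewrite /cpair; lia.
  by exists b => //; rewrite /cpair; nia.
have psiE a b : L a -> L b -> psi (cpair a b) = b.
  move=> La Lb; apply: last_sat_uniq => [||i [j _ [_ [_ /cpair_inj[]]]]//].
    by rewrite /cpair; nia.
  by exists a => //; rewrite /cpair; lia.
pose A := range (fun n => cpair (h n) (h n.+1)).
have infA : infinite_set A.
  move=> /(finite_preimage (f := fun n => cpair (h n) (h n.+1))) finA.
  apply: infinite_nat.
  apply: sub_finite_set (finA _) => [n _|m n _ _ /cpair_inj[/hinj//]].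
  by exists n.
have Alt k : exists N, forall p, N <= p -> A p -> lt (h k) (phi p).
  (* Only the neighbours [h i], [h i.+1] with [i <= k] have first component at most [h k]; the bound
     exceeds their codes. *)
  exists (\max_(i < k.+1) cpair (h i) (h i.+1)).+1 => p + [n _ pE].
  rewrite -pE phiE // hlt; apply: contraTT; rewrite -!leqNgt => le_nk.
  exact: (leq_bigmax (F := fun i : 'I_k.+1 => cpair (h i) (h i.+1))
    (@Ordinal k.+1 n le_nk)).
have sA : semidecidable (fun v => ~ A (v 0)).
  (* [p] fails to code neighbours exactly when it codes no increasing pair or some element lies
     strictly between: a decidable condition or an existential one. *)
  apply: (semidecidable_ext (P := fun v =>
      ~ (lt (phi (v 0)) (psi (v 0)) /\ v 0 = cpair (phi (v 0)) (psi (v 0))) \/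
      exists z, lt (phi (v 0)) z /\ lt z (psi (v 0)))).
    move=> v; move: (v 0) => p; split=> [+ [n _ pE]|nA].
      rewrite -pE phiE // psiE // !hlt => -[[]//|[z []]].
      case: (pselect (L z)) => [/hsurj[m ->]|nLz /ltL[]//].
      by rewrite !hlt; lia.
    apply: contrapT => /not_orP[/contrapT[ltp pE] nz]; apply: nA.
    have [n hn] := hsurj _ (Lphi p); have [m hm] := hsurj _ (Lpsi p).
    move: ltp pE nz; rewrite hn hm hlt => ltnm pE nz.
    exists n => //; rewrite pE; congr (cpair _ (h _)).
    move: ltnm; rewrite leq_eqVlt => /predU1P[//|ltnm].
    by case: nz; exists (h n.+1); rewrite !hlt.
  apply: semidecidable_or.
    apply/semidecidable_dec/decidable_not/decidable_and.
      exact: decidable_app2 dlt cphi cpsi.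
    exact: decidable_eq (computable_var 0) (computable_cpair cphi cpsi).
  apply: semidecidable_ex; apply/semidecidable_dec/decidable_and.
    exact: decidable_app2 dlt (computable_shift cphi) (computable_var 0).
  exact: decidable_app2 dlt (computable_var 0) (computable_shift cpsi).
have [C [CA Pi2C cohC]] := Pi2_cohesive_subset infA sA.
exists C; split=> //.
have totalP (f : nat -> nat) : computable_fun (fun v => f (v 0)) ->
    (forall n, L (f n)) -> power_fun L C (fun n => Some (f n)).
  move=> cf Lf; split=> [|n y [<-]//|]; first exact: partial_computable_total.
  by apply/almost_subsetP; exists 0 => n _ _; exists (f n).
have phiP := totalP _ cphi Lphi; have psiP := totalP _ cpsi Lpsi.
have constP i := totalP (fun=> h i) (computable_const _) (fun=> Lh i).
apply: (adjacent_not_omega_plus_eta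
  (K := power_class L C (fun n => Some (phi n)))
  (H := power_class L C (fun n => Some (psi n)))
  (u := fun i => power_class L C (fun=> Some (h i)))).
- by eexists; first exact: phiP.
- by eexists; first exact: psiP.
- apply/power_ltE => //; apply/almost_subsetP; exists 0 => p _ /CA[n _ <-].
  exists (h n), (h n.+1); rewrite phiE // psiE //; split=> //.
  exact/hlt.
- move=> [_ [[theta thetaP <-]]].
  move=> /(power_ltE _ phiP thetaP) lt1 /(power_ltE _ thetaP psiP) lt2.
  (* As [C] is infinite, one of its points codes neighbours with a value of [theta] strictly between
     them, which is absurd. *)
  have /almost_subsetP[N NP] := almost_subsetI lt1 lt2.
  have [/infinite_natP/(_ N)[p leNp Cp] _] := cohC.
  have [[a [z [[<-] tz ltaz]]] [z' [b [tz' [<-] ltzb]]]] := NP p leNp Cp.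
  move: ltaz ltzb; have -> : z' = z by move: tz'; rewrite tz => -[].
  have [n _ <-] := CA p Cp; rewrite phiE // psiE //.
  case: (pselect (L z)) => [/hsurj[m ->]|nLz /ltL[]//].
  by rewrite !hlt; lia.
- move=> i; split; first by eexists; first exact: constP.
  apply/power_ltE => //; have [N NP] := Alt i.
  apply/almost_subsetP; exists N => p leNp /CA Ap.
  by exists (h i), (phi p); split=> //; apply: NP.
move=> i; apply/power_ltE => //; apply/almost_subsetP; exists 0 => p _ _.
by exists (h i), (h i.+1); split=> //; apply/hlt.
Qed.
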